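(* Let $\mathcal{R}$ be the family of pairs $(v,w)$ of distinct binary words of the same length such that $\Omega^*_{v,w}(v) = \Omega^*_{v,w}(w)$. Then: (i) For $(v,w)\in\mathcal{R}$ and every $p \in (0,1)$, $$\mathrm{Win}(v,w;p) = \frac{\mathbb{P}_p(v)}{\mathbb{P}_p(v) + \mathbb{P}_p(w)} = \frac{p^s}{p^s + (1-p)^s}, \quad s = \|v\|_1 - \|w\|_1.$$ (ii) If $(v,w)\in\mathcal{R}$, then $\mathrm{Win}(v,w;1-p) = 1 - \mathrm{Win}(v,w;p)$ for all $p \in (0,1)$; if moreover $\|v\|_1 = \|w\|_1$, then $\mathrm{Win}(v,w;p) = \tfrac12$ for all $p\in(0,1)$. (iii) There is an algorithm which decides whether a given pair $(v,w)$ of words of the same length belongs to $\mathcal{R}$ in time polynomial in the length of the words.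
   Context: For $p\in(0,1)$, let $\mathbb{P}_p$ denote the law of an i.i.d. sequence $X_1, X_2, \ldots$ of bits with $\mathbb{P}_p(X_i = 1) = p$; for a finite word $u$, $\mathbb{P}_p(u) = p^{\|u\|_1}(1-p)^{\|u\|_0}$, where $\|u\|_a$ is the number of letters of $u$ equal to $a$. For a binary word $u = u_1\cdots u_r$, $\tau_u = \min\{t \in \mathbb{N} : X_{t-r+1}\cdots X_t = u_1\cdots u_r\}$, and $\mathrm{Win}(v,w;p) = \mathbb{P}_p(\tau_v < \tau_w)$. For binary words $v,w$ of the same length, $\Omega_{v,w}(v)$ is the set of finite binary words $u$ that end with $v$, in which $v$ occurs as a contiguous subword only as the suffix, and in which $w$ does not occur as a contiguous subword; $\Omega_{v,w}(w)$ is defined symmetrically, and $\Omega^*_{v,w}(v) = \{x : xv \in \Omega_{v,w}(v)\}$, $\Omega^*_{v,w}(w) = \{x : xw \in \Omega_{v,w}(w)\}$ (juxtaposition is concatenation). *)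

(* Defs.v *)
From HB Require Import structures.
From mathcomp Require Import all_boot all_order all_algebra.
From mathcomp Require Import finmap.
From mathcomp Require Import all_classical all_reals all_analysis.

Set Implicit Arguments.
Unset Strict Implicit.
Unset Printing Implicit Defensive.

Import Order.TTheory GRing.Theory Num.Theory.
Local Open Scope classical_set_scope.
Local Open Scope ring_scope.

(** * Words over {0, 1} ([true] is the letter 1) *)

Definition word := seq bool.

(* [norm1 u] is ||u||_1 and [norm0 u] is ||u||_0. *)
Definition norm1 (u : word) : nat := count_mem true u.
Definition norm0 (u : word) : nat := count_mem false u.

(* [Omega a b] is Omega_{a,b}(a); thus
   Omega_{v,w}(v) is [Omega v w] and Omega_{v,w}(w) is [Omega w v]. *)
Definition Omega (a b : word) : set word :=
  [set u | [/\ suffix a u,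
               forall x y : word, u = x ++ a ++ y -> y = [::]
             & ~~ infix b u]].

(* [OmegaStar a b] is Omega^*_{a,b}(a). *)
Definition OmegaStar (a b : word) : set word := [set x | Omega a b (x ++ a)].

Definition calR (v w : word) : Prop :=
  [/\ v <> w, size v = size w & OmegaStar v w = OmegaStar w v].

(** * Waiting times in an i.i.d. sequence of bits *)

Definition word_prob (R : realType) (p : R) (u : word) : R :=
  p ^+ norm1 u * (1 - p) ^+ norm0 u.

(* [X i] stands for the bit X_{i+1}. *)
Definition iid_bits (R : realType) (d : measure_display) (T : measurableType d)
    (P : probability T R) (X : nat -> {RV P >-> bool}) (p : R) : Prop :=
  (forall i, P (X i @^-1` [set true]) = p%:E) /\
  (forall (J : {fset nat}) (B : nat -> set bool),
     P (\bigcap_(j in [set` J]) X j @^-1` B j) =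
     (\prod_(j <- J) P (X j @^-1` B j))%E).

Arguments iid_bits {R d T} P X p.

(* X_{t-r+1} ... X_t = u, where r is the length of u; this needs r <= t. *)
Definition occurs_at (x : nat -> bool) (u : word) (t : nat) : Prop :=
  (size u <= t)%N /\ [seq x i | i <- iota (t - size u) (size u)] = u.

(* The infimum is a minimum, or +oo when u never occurs. *)
Definition hitting_time (R : realType) (x : nat -> bool) (u : word) : \bar R :=
  ereal_inf [set t%:R%:E | t in [set t : nat | occurs_at x u t]].

Definition Win (R : realType) (d : measure_display) (T : measurableType d)
    (P : probability T R) (X : nat -> {RV P >-> bool}) (v w : word) : \bar R :=
  P [set o | (hitting_time R (fun i => X i o) v
              < hitting_time R (fun i => X i o) w)%E].

Arguments Win {R d T} P X v w.

(** * Deterministic multi-tape Turing machines *)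

Inductive symbol := Blank | Sep | Bit of bool.

Inductive move := MoveL | MoveR | Stay.

(* A two-way infinite tape: [lft] and [rgt] list the cells on either side of
   the head, nearest first; all cells beyond these lists are blank. *)
Record tape := Tape { lft : seq symbol; cur : symbol; rgt : seq symbol }.

Definition blank_tape : tape := Tape [::] Blank [::].

Definition input_tape (s : seq symbol) : tape :=
  if s is a :: s' then Tape [::] a s' else blank_tape.

Definition write_move (t : tape) (am : symbol * move) : tape :=
  let: (a, m) := am in
  match m with
  | MoveL => Tape (behead (lft t)) (head Blank (lft t)) (a :: rgt t)
  | MoveR => Tape (a :: lft t) (head Blank (rgt t)) (behead (rgt t))
  | Stay => Tape (lft t) a (rgt t)
  end.

(* A state q is halting when [answer q] is [Some b]; b tells whether the
   machine accepts. *)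
Record TM := MkTM {
  state : finType;
  tapes : nat;  (* there are [tapes.+1] tapes, the first one being the input *)
  start : state;
  answer : state -> option bool;
  delta : state -> ('I_tapes.+1 -> symbol) ->
          state * ('I_tapes.+1 -> symbol * move) }.

Record config (M : TM) := Config {
  cstate : state M;
  ctapes : 'I_(tapes M).+1 -> tape }.

Definition step (M : TM) (c : config M) : config M :=
  if answer (cstate c) is Some _ then c
  else let: (q, act) := delta (cstate c) (fun i => cur (ctapes c i)) in
       Config q (fun i => write_move (ctapes c i) (act i)).

Definition init (M : TM) (s : seq symbol) : config M :=
  Config (start M) (fun i => if i == ord0 then input_tape s else blank_tape).

(* [step] does not change halted configurations, so [n] is an upper bound on
   the running time. *)
Definition halts_within (M : TM) (s : seq symbol) (n : nat) (b : bool) : Prop :=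
  answer (cstate (iter n (@step M) (init M s))) = Some b.

Definition encode_pair (v w : word) : seq symbol :=
  map Bit v ++ Sep :: map Bit w.

(* Polynomial-time decidability of a relation on pairs of words of the same
   length; nothing is required on the other pairs. *)
Definition polytime_decidable (D : word -> word -> Prop) : Prop :=
  exists (M : TM) (f : {poly nat}), forall v w : word, size v = size w ->
    exists2 b : bool, halts_within M (encode_pair v w) f.[size v] b
                    & b <-> D v w.

(* Main.v *)
(* With S the common value of Omega^*_{v,w}(v) and Omega^*_{v,w}(w), the event
   {tau_v < tau_w} is the disjoint union over x in S of the cylinders of the
   words xv, so that its probability is P(v) P(S), where P(S) denotes the sum of
   P(x) over x in S; symmetrically P(tau_w < tau_v) = P(w) P(S).  As v occurs
   almost surely and ties are impossible, the two probabilities add up to 1.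

   For (iii), an occurrence of c in {v,w} in the word xa, a in {v,w}, which
   straddles the end of x meets x in a prefix z of c such that the rest of c is
   a prefix of a.  Hence Omega^*_{v,w}(a) consists of the words avoiding v and w
   which have no suffix in the set F(a) of these prefixes z.  Two such sets
   coincide if and only if every element of F(v) has a suffix in F(w) and
   conversely.  This only compares factors of v and w, hence can be tested
   by three heads moving on v and w.  Such a device has polynomially many
   configurations, so its running time is polynomial as soon as it halts. *)

Require Import Defs.
From HB Require Import structures.
From mathcomp Require Import all_boot all_order all_algebra.
From mathcomp Require Import finmap zify ring lra.
From mathcomp Require Import all_classical all_reals all_analysis.

Import Order.TTheory GRing.Theory Num.Theory numFieldNormedType.Exports.
Local Open Scope classical_set_scope.
Local Open Scope ring_scope.

Set Implicit Arguments.
Unset Strict Implicit.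
Unset Printing Implicit Defensive.

(** * The characterization of R by overlaps *)

Section Criterion.
Local Open Scope nat_scope.

Lemma infix_eq (T : eqType) (s t : seq T) :
  infix s t -> size s = size t -> s = t.
Proof.
move=> /infixP[x1 [x2 ->]]; rewrite !size_cat => E.
have /size0nil -> : size x1 = 0 by lia.
have /size0nil -> : size x2 = 0 by lia.
by rewrite cats0.
Qed.

(** For words of equal length: [c] can straddle the end of [x] in [x ++ a] with exactly its first
    [i] letters inside [x]. For [i = size a] both sides are empty, so the test succeeds and
    describes an occurrence ending with [x]; for [i = 0] it means [c = a]. *)
Definition overlap (a c : word) (i : nat) : bool :=
  drop i c == take (size a - i) a.

Definition bad (a b x : word) : Prop :=
  exists2 c, c = a \/ c = b &
    infix c x \/
    exists2 i, 0 < i <= size a & overlap a c i /\ suffix (take i c) x.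

(** An occurrence of [a] or [b] in [x ++ a] lies inside [x], straddles the end of [x], or is the
    final [a]. [bad] collects the first two cases. In the third case the word is [a] itself, as the
    lengths agree and [a <> b]. *)
Lemma badE a b x : a <> b -> size a = size b ->
  OmegaStar a b x <-> ~ bad a b x.
Proof.
move=> ab sz.
have szc c : c = a \/ c = b -> size c = size a by case=> ->.
split.
  case=> _ occ nb [c cab [/infixP[x1 [x2 E]]|[i /andP[i0 ia] [/eqP ov /suffixP[x1 E]]]]].
    case: cab => ?; subst c.
      have := occ x1 (x2 ++ a); rewrite E -!catA => /(_ erefl)/(congr1 size) /=.
      rewrite size_cat => /eqP; rewrite addn_eq0 => /andP[_ /nilP a0]; apply: ab.
      by rewrite a0; apply/esym/nilP; rewrite /nilp -sz a0.
    by case/negP: nb; apply/infixP; exists x1, (x2 ++ a); rewrite E -!catA.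
  have Ex : x ++ a = x1 ++ c ++ drop (size a - i) a.
    by rewrite E -{2}(cat_take_drop i c) ov -!catA cat_take_drop.
  case: cab => ?; subst c.
    have := occ _ _ Ex => /(congr1 size); rewrite size_drop /=; lia.
  by case/negP: nb; rewrite Ex; apply/infixP; exists x1, (drop (size a - i) a).
move=> nbad.
have key c x1 y : c = a \/ c = b -> x ++ a = x1 ++ c ++ y -> y = [::].
  move=> cab E; case: (posnP (size y)) => [/size0nil//|y0]; case: nbad.
  have sc := szc _ cab; exists c => //.
  have szE := congr1 size E; rewrite !size_cat sc in szE.
  case: (leqP (size a) (size y)) => ya.
    left; apply/infixP; exists x1, (take (size x - size x1 - size c) y).
    have := congr1 (take (size x)) E.
    rewrite take_size_cat // => {1}->.
    rewrite take_cat ifF; last by lia.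
    rewrite take_cat ifF; last by lia.
    by [].
  (* Since [c] and [a] have the same length, the number of letters of [c] inside [x] equals the
     number of letters of [a] that follow [c]. *)
  right; exists (size y); first by lia.
  have /eqP : x ++ a = (x1 ++ take (size y) c) ++ (drop (size y) c ++ y).
    by rewrite -catA (catA (take _ _)) cat_take_drop.
  have szx : size x = size (x1 ++ take (size y) c).
    by rewrite size_cat size_takel ?sc 1?ltnW //; lia.
  rewrite eqseq_cat //.
  case/andP=> /eqP Ex /eqP Ea; split.
    apply/eqP; have := congr1 (take (size a - size y)) Ea => ->.
    by rewrite take_size_cat // size_drop sc.
  by apply/suffixP; exists x1.
split; first exact: suffix_suffix.
  by move=> x1 y; apply: key; left.
apply/negP => /infixP[x1 [y E]].
have y0 := key b x1 y (or_intror erefl) E.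
have szx : size x = size x1.
  by have := congr1 size E; rewrite y0 !size_cat /= sz; lia.
move/eqP: E; rewrite y0 cats0 eqseq_cat //.
by case/andP=> _ /eqP.
Qed.

(** This is the condition that every element of F(v) has a suffix in F(w), the elements of F(v)
    being the words [take i c]. *)
Definition covers (v w : word) : Prop :=
  forall c i, c = v \/ c = w -> 0 < i <= size v -> overlap v c i ->
  exists b j, [/\ b = v \/ b = w, 0 < j <= size w, overlap w b j
                & suffix (take j b) (take i c)].

(** From left to right, the inclusion is tested on the elements of F(v) themselves, which are bad
    for [v]. From right to left, being a suffix is transitive. *)
Lemma bad_covers v w : size v = size w ->
  (forall x, bad v w x -> bad w v x) <-> covers v w.
Proof.
move=> sz; split=> [H c i cvw i1 ov|H x [c cvw [cx|[i i1 [ov cx]]]]].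
- have sc : size c = size v by case: cvw => ->.
  have /H : bad v w (take i c).
    by exists c => //; right; exists i => //; split => //; exact: suffix_refl.
  case=> b bwv.
  have sb : size b = size w by case: bwv => ->.
  have bvw : b = v \/ b = w by case: bwv; [right|left].
  case=> [bx|[j j1 [ovb bc]]]; last by exists b, j.
  (* A word [b] inside [take i c] must fill it, by length. It is then itself an element of F(w),
     through the empty overlap at [size b]. *)
  exists b, (size b); split=> //; first by lia.
    by rewrite /overlap drop_size sb subnn take0 eqxx.
  have sbi : size b <= size (take i c) by exact: size_infix.
  rewrite size_takel ?sc in sbi; last by lia.
  have Ei : i = size c by lia.
  have szb : size b = size c by lia.
  move: bx; rewrite Ei !take_size => /infix_eq -> //; exact: suffix_refl.
- by exists c; [case: cvw; [right|left] | left].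
- have [b [j [bvw j1 ovb bc]]] := H c i cvw i1 ov.
  exists b; first by case: bvw; [right|left].
  by right; exists j => //; split=> //; apply: suffix_trans bc cx.
Qed.

Lemma calR_covers v w : size v = size w ->
  calR v w <-> [/\ v <> w, covers v w & covers w v].
Proof.
move=> sz; split.
  case=> vw _ E; have wv : w <> v by move=> /esym.
  have Ex x : ~ bad v w x <-> ~ bad w v x.
    apply: iff_trans (iff_sym (badE x vw sz)) _; rewrite E.
    exact: badE x wv (esym sz).
  split=> //; apply/bad_covers => // x; apply: contraPP => nb.
    exact: (Ex x).2.
  exact: (Ex x).1.
case=> vw /(bad_covers sz) H1 /(bad_covers (esym sz)) H2.
have wv : w <> v by move=> /esym.
split=> //; apply/seteqP; split=> x.
  by move/(badE x vw sz) => nb; apply/(badE x wv (esym sz)) => /H2.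
by move/(badE x wv (esym sz)) => nb; apply/(badE x vw sz) => /H1.
Qed.
End Criterion.

(** * Multi-head automata *)

Section Gadgets.
Local Open Scope nat_scope.

(* Each of the three heads reads both words at once: in the simulation below
   it is a pair of tapes, holding v and w, whose heads move in lockstep. *)
Definition head_name := option bool.

Definition view := head_name -> bool -> symbol.

(* An automaton with two exits, the booleans. *)
Record gadget := Gadget {
  gstate : finType;
  gstart : gstate;
  gtrans : gstate -> view -> (gstate + bool) * (head_name -> move) }.

(** Cell 0 carries the marker, cells 1 to [n] the letters, cell [n.+1] the first blank. Moves
    saturate at both ends, so positions form a finite type. *)
Definition shift (n : nat) (m : move) (x : nat) : nat :=
  match m with MoveL => x.-1 | MoveR => minn x.+1 n.+1 | Stay => x end.

Definition atom (c : view -> bool) (mv : head_name -> move) : gadget :=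
  @Gadget unit tt (fun _ u => (inr (c u), if c u then mv else fun=> Stay)).

Definition branch (g h k : gadget) : gadget :=
  @Gadget (gstate g + (gstate h + gstate k))%type (inl (gstart g))
    (fun q u => match q with
      | inl s => let: (q', mv) := gtrans s u in
          (match q' with
           | inl s' => inl (inl s')
           | inr true => inl (inr (inl (gstart h)))
           | inr false => inl (inr (inr (gstart k)))
           end, mv)
      | inr (inl s) => let: (q', mv) := gtrans s u in
          (match q' with inl s' => inl (inr (inl s')) | inr b => inr b end, mv)
      | inr (inr s) => let: (q', mv) := gtrans s u in
          (match q' with inl s' => inl (inr (inr s')) | inr b => inr b end, mv)
      end).

(** Exit [true] of the body starts another round. The loop itself only leaves by [true], so its
    outcome has to be read off the head positions afterwards. *)
Definition loop (g : gadget) : gadget :=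
  @Gadget (gstate g) (gstart g)
    (fun s u => let: (q', mv) := gtrans s u in
      (match q' with
       | inl s' => inl s'
       | inr true => inl (gstart g)
       | inr false => inr true
       end, mv)).

Definition guard (c : view -> bool) : gadget := atom c (fun=> Stay).
Definition ret (b : bool) : gadget := guard (fun=> b).
Definition seqg (g h : gadget) : gadget := branch g h h.
Definition notg (g : gadget) : gadget := branch g (ret false) (ret true).
Definition andg (g h : gadget) : gadget := branch g h (ret false).
Definition org (g h : gadget) : gadget := branch g (ret true) h.
Definition while (c : view -> bool) (mv : head_name -> move) : gadget :=
  loop (atom c mv).

Definition is_blank (a : symbol) : bool := if a is Blank then true else false.
Definition is_sep (a : symbol) : bool := if a is Sep then true else false.
Definition same_bit (a b : symbol) : bool :=
  match a, b with Bit x, Bit y => x == y | _, _ => false end.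

(** The test precedes the rewinding, which destroys the positions it depends on; its result is
    remembered in the control state, by having two copies of [back]. *)
Definition finish (t : view -> bool) (h : head_name) (mv : head_name -> move) : gadget :=
  let back := while (fun u => ~~ is_sep (u h true)) mv in
  branch (guard t) (seqg back (ret true)) (seqg back (ret false)).

Definition pick3 (A : Type) (a b c : A) (h : head_name) : A :=
  match h with None => a | Some true => b | Some false => c end.

Definition head_i : head_name := None.
Definition head_j : head_name := Some true.
Definition head_k : head_name := Some false.

Definition drive (h : head_name) (m : move) : head_name -> move :=
  fun y => if y == h then m else Stay.

Definition drive2 (h : head_name) (m : move) : head_name -> move :=
  fun y => if (y == h) || (y == head_k) then m else Stay.

(** Linear search: the body asks for another round when [g] fails, and stops on a success or on the
    blank. [finish] distinguishes these two endings and brings [h] back to the marker. *)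
Definition existsg (h : head_name) (g : gadget) : gadget :=
  seqg
    (loop (seqg (atom (fun=> true) (drive h MoveR))
       (branch (guard (fun u => is_blank (u h true))) (ret false) (notg g))))
    (finish (fun u => ~~ is_blank (u h true)) h (drive h MoveL)).

(* In [overlapg] and [suffixg] the head k, initially on the left marker,
   counts the moves of the other heads, so that [finish] can undo them. *)
Definition overlapg (h : head_name) (s c : bool) : gadget :=
  seqg (atom (fun=> true) (drive2 h MoveR))
    (seqg (while (fun u => same_bit (u h c) (u head_k s)) (drive2 h MoveR))
       (finish (fun u => is_blank (u h c)) head_k (drive2 h MoveL))).

Definition suffixg (c b : bool) : gadget :=
  seqg (while (fun u => same_bit (u head_i c) (u head_j b))
          (pick3 MoveL MoveL MoveR))
    (finish (fun u => is_sep (u head_j b)) head_k (pick3 MoveR MoveR MoveL)).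

Definition coversg (s c : bool) : gadget :=
  let witness b := andg (overlapg head_j (~~ s) b) (suffixg c b) in
  notg (existsg head_i (andg (overlapg head_i s c)
    (notg (existsg head_j (org (witness true) (witness false)))))).

(** The machine starts this gadget with all heads on the first blank, hence the initial rewinding.
    With the heads on the markers, the overlap test is the one for [i = 0], that is, equality of the
    two words. *)
Definition calRg : gadget :=
  seqg (while (fun u => ~~ is_sep (u head_i true)) (fun=> MoveL))
    (andg (notg (overlapg head_i false true))
       (andg (andg (coversg true true) (coversg true false))
          (andg (coversg false true) (coversg false false)))).

(** * Runs of gadgets on two words, and correctness of the tests *)

Section Runs.
Variables (n : nat) (W : bool -> word).

Definition cell (s : bool) (x : nat) : symbol :=
  nth Blank (Sep :: map Bit (W s)) x.

Definition positions := {ffun head_name -> 'I_n.+2}.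

Definition views (p : positions) : view := fun y s => cell s (p y).

Definition moves (p : positions) (mv : head_name -> move) : positions :=
  [ffun y => inord (shift n (mv y) (p y))].

Definition gconfig (g : gadget) : finType := ((gstate g + bool) * positions)%type.

Definition gstep (g : gadget) (c : gconfig g) : gconfig g :=
  match c.1 with
  | inl s => let: (q, mv) := gtrans s (views c.2) in (q, moves c.2 mv)
  | inr _ => c
  end.

(** Reachability in a finite type leaves the number of steps unspecified; it is recovered at the end
    from the number of configurations. *)
Definition runs (g : gadget) (p : positions) (b : bool) (p' : positions) : Prop :=
  fconnect (@gstep g) (inl (gstart g), p) (inr b, p').

Lemma moves_stay p : moves p (fun=> Stay) = p.
Proof. by apply/ffunP => y; rewrite ffunE /= inord_val. Qed.

(** This serves to compose gadgets: [e] places a component inside a larger gadget and may send its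
    halted configurations to the entry of the next component. Only steps from non-final
    configurations have to be simulated, as final ones are fixed by [f]. *)
Lemma fconnect_embed (A B : finType) (f : A -> A) (h : B -> B) (e : A -> B)
    (final : pred A) :
  (forall a, final a -> f a = a) ->
  (forall a, ~~ final a -> h (e a) = e (f a)) ->
  forall a a', fconnect f a a' -> fconnect h (e a) (e a').
Proof.
move=> ff fe a a' /iter_findex <-; elim: (findex f a a') => [|m IH] /=.
  exact: connect0.
apply: connect_trans IH _; set c := iter m f a.
have [fc|nfc] := boolP (final c); first by rewrite ff // connect0.
by rewrite -fe // fconnect1.
Qed.

Definition halted (g : gadget) : pred (gconfig g) :=
  fun c => if c.1 is inr _ then true else false.

Lemma halted_step g (c : gconfig g) : halted c -> gstep c = c.
Proof. by case: c => -[s|b] p. Qed.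

Lemma runs_atom (c : view -> bool) mv p :
  runs (atom c mv) p (c (views p)) (if c (views p) then moves p mv else p).
Proof.
rewrite /runs; set c' := (inr _, _).
have -> : c' = gstep (inl (gstart (atom c mv)), p).
  by rewrite /c' /gstep /=; case: (c _); rewrite ?moves_stay.
exact: fconnect1.
Qed.

Lemma runs_branch g h k p b p' b' p'' :
  runs g p b p' -> runs (if b then h else k) p' b' p'' ->
  runs (branch g h k) p b' p''.
Proof.
move=> gp hk.
pose eg (c : gconfig g) : gconfig (branch g h k) :=
  (match c.1 with
   | inl s' => inl (inl s')
   | inr true => inl (inr (inl (gstart h)))
   | inr false => inl (inr (inr (gstart k)))
   end, c.2).
have step_g c : ~~ halted c -> gstep (eg c) = eg (gstep c).
  by case: c => -[s|//] q _; rewrite /gstep /=; case: (gtrans s _).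
have := fconnect_embed (@halted_step g) step_g gp => /connect_trans; apply.
pose eh (c : gconfig h) : gconfig (branch g h k) :=
  (match c.1 with inl s => inl (inr (inl s)) | inr b => inr b end, c.2).
have step_h c : ~~ halted c -> gstep (eh c) = eh (gstep c).
  by case: c => -[s|//] q _; rewrite /gstep /=; case: (gtrans s _).
pose ek (c : gconfig k) : gconfig (branch g h k) :=
  (match c.1 with inl s => inl (inr (inr s)) | inr b => inr b end, c.2).
have step_k c : ~~ halted c -> gstep (ek c) = ek (gstep c).
  by case: c => -[s|//] q _; rewrite /gstep /=; case: (gtrans s _).
case: b gp hk => _ hk.
  exact: (fconnect_embed (@halted_step h) step_h hk).
exact: (fconnect_embed (@halted_step k) step_k hk).
Qed.

Lemma runs_loop_step g p b p' : runs g p b p' ->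
  fconnect (@gstep (loop g)) (inl (gstart g), p)
    (if b then inl (gstart g) else inr true, p').
Proof.
move=> gp.
pose e (c : gconfig g) : gconfig (loop g) :=
  (match c.1 with
   | inl s' => inl s'
   | inr true => inl (gstart g)
   | inr false => inr true
   end, c.2).
have step_e c : ~~ halted c -> gstep (e c) = e (gstep c).
  by case: c => -[s|//] q _; rewrite /gstep /=; case: (gtrans s _).
by have := fconnect_embed (@halted_step g) step_e gp; case: b gp.
Qed.

Lemma runs_loop g (f : nat -> positions) m p' :
  (forall t, t < m -> runs g (f t) true (f t.+1)) ->
  runs g (f m) false p' -> runs (loop g) (f 0) true p'.
Proof.
move=> Ht Hf.
suff H t : t <= m -> fconnect (@gstep (loop g)) (inl (gstart g), f 0)
    (inl (gstart g), f t).
  by apply: connect_trans (H m (leqnn m)) _; exact: runs_loop_step Hf.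
elim: t => [_|t IH tm]; first exact: connect0.
by apply: connect_trans (IH (ltnW tm)) _; exact: runs_loop_step (Ht t tm).
Qed.

Lemma runs_while (c : view -> bool) mv (f : nat -> positions) m :
  (forall t, t < m -> c (views (f t)) /\ moves (f t) mv = f t.+1) ->
  ~~ c (views (f m)) -> runs (while c mv) (f 0) true (f m).
Proof.
move=> Ht nc; apply: (@runs_loop _ f m).
  by move=> t /Ht[ct <-]; have := runs_atom c mv (f t); rewrite ct.
by have := runs_atom c mv (f m); rewrite (negbTE nc).
Qed.

Lemma runs_seq g h p b p' b' p'' :
  runs g p b p' -> runs h p' b' p'' -> runs (seqg g h) p b' p''.
Proof. by move=> gp hp; apply: runs_branch gp _; case: b. Qed.

Lemma runs_guard (c : view -> bool) p : runs (guard c) p (c (views p)) p.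
Proof.
by have := runs_atom c (fun=> Stay) p; rewrite moves_stay if_same.
Qed.

Lemma runs_ret b p : runs (ret b) p b p.
Proof. exact: runs_guard. Qed.

(** Requiring all heads to return to where they started makes tests closed under Boolean
    combinations. *)
Definition decides (g : gadget) (p : positions) (b : bool) := runs g p b p.

Lemma decides_not g p b : decides g p b -> decides (notg g) p (~~ b).
Proof. by move=> gp; apply: runs_branch gp _; case: b; exact: runs_ret. Qed.

Lemma decides_and g h p b c :
  decides g p b -> decides h p c -> decides (andg g h) p (b && c).
Proof.
by move=> gp hp; apply: runs_branch gp _; case: b => //; exact: runs_ret.
Qed.

Lemma decides_or g h p b c :
  decides g p b -> decides h p c -> decides (org g h) p (b || c).
Proof.
by move=> gp hp; apply: runs_branch gp _; case: b => //; exact: runs_ret.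
Qed.

Lemma runs_finish t h mv (f : nat -> positions) m :
  (forall l, l < m -> ~~ is_sep (views (f l.+1) h true) /\
     moves (f l.+1) mv = f l) ->
  is_sep (views (f 0) h true) ->
  runs (finish t h mv) (f m) (t (views (f m))) (f 0).
Proof.
move=> Hm H0.
have Hb : runs (while (fun u => ~~ is_sep (u h true)) mv) (f m) true (f 0).
  (* Rewinding visits the positions [f] in reverse order. *)
  have := @runs_while (fun u => ~~ is_sep (u h true)) mv (fun l => f (m - l)) m.
  rewrite subn0 subnn; apply; last by rewrite H0.
  move=> l lm; have -> : m - l = (m - l.+1).+1 by lia.
  by apply: Hm; lia.
apply: runs_branch (runs_guard _ _) _.
by case: (t _); apply: runs_seq Hb (runs_ret _ _).
Qed.

Hypothesis sizeW : forall s, size (W s) = n.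

Lemma cell_in s x : x < n -> cell s x.+1 = Bit (nth false (W s) x).
Proof. by move=> xn; rewrite /cell /= (nth_map false) ?sizeW. Qed.

Lemma is_sep_cell s x : is_sep (cell s x) = (x == 0).
Proof.
case: x => [|x] //; have [xn|nx] := ltnP x n; first by rewrite cell_in.
by rewrite /cell /= nth_default // size_map sizeW.
Qed.

Lemma is_blank_cell s x : is_blank (cell s x) = (n < x).
Proof.
case: x => [|x] //; have [xn|nx] := ltnP x n.
  by rewrite cell_in // ltnS leqNgt xn.
by rewrite /cell /= nth_default ?size_map ?sizeW // ltnS nx.
Qed.

Lemma same_bit_cell s c x y : same_bit (cell s x.+1) (cell c y.+1) =
  [&& x < n, y < n & nth false (W s) x == nth false (W c) y].
Proof.
have [xn|nx] := ltnP x n; last first.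
  by rewrite /cell /= nth_default // size_map sizeW.
have [yn|ny] := ltnP y n; last first.
  by rewrite {2}/cell /= (@nth_default _ _ _ y) ?size_map ?sizeW // cell_in.
by rewrite !cell_in.
Qed.

Definition place (a b c : nat) : positions := [ffun y => inord (pick3 a b c y)].

Lemma views_place a b c h s : a <= n.+1 -> b <= n.+1 -> c <= n.+1 ->
  views (place a b c) h s = cell s (pick3 a b c h).
Proof. by move=> *; rewrite /views ffunE inordK //; case: h => [[]|]. Qed.

Lemma moves_place a b c mv : a <= n.+1 -> b <= n.+1 -> c <= n.+1 ->
  moves (place a b c) mv = place (shift n (mv head_i) a)
    (shift n (mv head_j) b) (shift n (mv head_k) c).
Proof.
by move=> *; apply/ffunP => y; rewrite !ffunE inordK //; case: y => [[]|].
Qed.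

(** In [f t] the head [h] is on cell [t]. If [m] is the index of the first witness in [iota 1 n], or
    [n] when there is none, the search stops on cell [m.+1], which is blank exactly when no witness
    exists. *)
Lemma decides_exists h g (f : nat -> positions) (P : nat -> bool) :
  (forall t, t <= n.+1 -> views (f t) h true = cell true t) ->
  (forall t, t <= n -> moves (f t) (drive h MoveR) = f t.+1) ->
  (forall t, t <= n -> moves (f t.+1) (drive h MoveL) = f t) ->
  (forall t, 0 < t <= n -> decides g (f t) (P t)) ->
  decides (existsg h g) (f 0) (has P (iota 1 n)).
Proof.
move=> fV fR fL gP; set m := find P (iota 1 n).
have mn : m <= n by rewrite -[leqRHS](size_iota 1) find_size.
have body t b : t <= n -> 
    (if t == n then b = false else b = ~~ P t.+1) ->
    runs (seqg (atom (fun=> true) (drive h MoveR))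
       (branch (guard (fun u => is_blank (u h true))) (ret false) (notg g)))
      (f t) b (f t.+1).
  move=> tn Hb; have := runs_atom (fun=> true) (drive h MoveR) (f t) => /= Ha.
  rewrite fR // in Ha; apply: runs_seq Ha _.
  apply: runs_branch (runs_guard _ _) _; rewrite fV // is_blank_cell ltnS.
  case: (altP (t =P n)) Hb => [-> ->|tn' ->]; first by rewrite leqnn; exact: runs_ret.
  by rewrite ifF; [apply: decides_not; apply: gP; lia|lia].
have nth_iota1 t : t < n -> nth 0 (iota 1 n) t = t.+1.
  by move=> tn; rewrite nth_iota.
have Hloop : runs (loop (seqg (atom (fun=> true) (drive h MoveR))
       (branch (guard (fun u => is_blank (u h true))) (ret false) (notg g))))
      (f 0) true (f m.+1).
  apply: (@runs_loop _ f m).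
    move=> t tm; apply: body; first by lia.
    rewrite ifF; last by lia.
    by have := before_find 0 tm; rewrite nth_iota1 => [->|] //; lia.
  apply: body => //; case: eqP => // /eqP mn'.
  have hP : has P (iota 1 n) by rewrite has_find size_iota -/m; lia.
  by have := nth_find 0 hP; rewrite -/m nth_iota1 => [->|] //; lia.
apply: runs_seq Hloop _; rewrite has_find size_iota -/m.
have -> : (m < n) = ~~ is_blank (views (f m.+1) h true).
  by rewrite fV // is_blank_cell -leqNgt.
apply: (runs_finish (fun u => ~~ is_blank (u h true))).
  move=> l lm; rewrite fV; last by lia.
  by rewrite is_sep_cell fL; last by lia.
by rewrite fV // is_sep_cell.
Qed.

(** The head [h] has advanced by [l] from cell [a], the head k counts [l], and the remaining head
    waits on cell [b]. *)
Definition along (h : head_name) (a b l : nat) : positions :=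
  if h == head_j then place b (a + l) l else place (a + l) b l.

(** The comparison stops after the longest common prefix, of length [m], of [drop a (W c)] and
    [W s]. The overlap holds if and only if [m = n - a], which is when [h] has reached the blank. *)
Lemma decides_overlap h s c a b : h <> head_k -> a <= n -> b <= n ->
  decides (overlapg h s c) (along h a b 0) (overlap (W s) (W c) a).
Proof.
move=> hk an bn; set f := along h a b.
have vh l z : a + l <= n.+1 -> views (f l) h z = cell z (a + l).
  by move=> al; case: h hk @f => [[]|] //= _; rewrite views_place //; lia.
have vk l z : a + l <= n.+1 -> views (f l) head_k z = cell z l.
  by move=> al; clear vh; case: h hk @f => [[]|] //= _; rewrite views_place //; lia.
have fR l : a + l <= n -> moves (f l) (drive2 h MoveR) = f l.+1.
  move=> al; clear vh vk; case: h hk @f => [[]|] //= _;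
    rewrite moves_place /along /drive2 /=; try lia;
    by congr place; lia.
have fL l : a + l <= n -> moves (f l.+1) (drive2 h MoveL) = f l.
  move=> al; clear vh vk fR; case: h hk @f => [[]|] //= _;
    rewrite moves_place /along /drive2 /=; try lia;
    by congr place; lia.
pose match_at l := same_bit (cell c (a + l.+1)) (cell s l.+1).
have exm : exists l, ~~ match_at l.
  by exists (n - a); rewrite /match_at addnS same_bit_cell; apply/negP; lia.
case: (ex_minnP exm) => m nm minm.
have matchE l : match_at l = (a + l < n) && (nth false (W c) (a + l) == nth false (W s) l).
  by rewrite /match_at addnS same_bit_cell; case: (ltnP (a + l) n) => //= ?;
    have -> : l < n by lia.
have mna : a + m <= n.
  rewrite leqNgt; apply/negP => H.
  have : m <= n - a by apply: minm; rewrite matchE; lia.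
  lia.
have prev l : l < m -> match_at l.
  by move=> lm; apply/negPn/negP => /minm; lia.
(* Cell [a] holds the last letter of the prefix of length [a], or the marker, so both heads first
   advance by one cell. *)
apply: (@runs_seq _ _ _ true (f 1)).
  by have := runs_atom (fun=> true) (drive2 h MoveR) (f 0); rewrite fR ?addn0.
apply: (@runs_seq _ _ _ true (f m.+1)).
  apply: (@runs_while _ _ (fun l => f l.+1)) => [l lm|].
    rewrite vh ?vk ?fR; try lia.
    by split=> //; exact: prev.
  by rewrite vh ?vk //; lia.
have -> : overlap (W s) (W c) a = is_blank (views (f m.+1) h c).
  rewrite vh; last by lia.
  rewrite is_blank_cell /overlap sizeW.
  have szd : size (drop a (W c)) = n - a by rewrite size_drop sizeW.
  have szt : size (take (n - a) (W s)) = n - a.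
    by rewrite size_takel // sizeW leq_subr.
  apply/eqP/idP => [E|H].
    rewrite addnS ltnS leqNgt; apply/negP => amn; move: nm; rewrite matchE amn /=.
    have := congr1 (fun u => nth false u m) E.
    by rewrite nth_drop nth_take; [move=> ->; rewrite eqxx|lia].
  apply: (@eq_from_nth _ false); rewrite szd ?szt // => l ln.
  rewrite nth_drop nth_take //; have := prev l; rewrite matchE => H2.
  by have /H2/andP[_ /eqP] : l < m by lia.
apply: (runs_finish (fun u => is_blank (u h c))).
  move=> l lm; rewrite vk ?fL; try lia.
  by rewrite is_sep_cell.
by rewrite vk ?is_sep_cell //; lia.
Qed.

(** Reading leftwards from cells [i] and [j], the heads agree along the longest common suffix, of
    length [m], of the two prefixes. The second prefix is exhausted, with head j on the marker, if
    and only if [m = j]. *)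
Lemma decides_suffix c b i j : i <= n -> j <= n ->
  decides (suffixg c b) (place i j 0) (suffix (take j (W b)) (take i (W c))).
Proof.
move=> i_n j_n; pose f l := place (i - l) (j - l) l.
pose match_at l := same_bit (cell c (i - l)) (cell b (j - l)).
have matchE l : match_at l = [&& l < i, l < j &
    nth false (W c) (i - l.+1) == nth false (W b) (j - l.+1)].
  rewrite /match_at; have [li|il] := ltnP l i; last first.
    by have /eqP -> : i - l == 0 by lia.
  have [lj|jl] := ltnP l j; last first.
    have /eqP -> : j - l == 0 by lia.
    by case: (cell c _).
  have -> : i - l = (i - l.+1).+1 by lia.
  have -> : j - l = (j - l.+1).+1 by lia.
  by rewrite same_bit_cell; lia.
have exm : exists l, ~~ match_at l.
  by exists i; rewrite matchE ltnn.
case: (ex_minnP exm) => m nm minm.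
have mi : m <= i by apply: minm; rewrite matchE ltnn.
have mj : m <= j by apply: minm; rewrite matchE ltnn andbF.
have prev l : l < m -> match_at l.
  by move=> lm; apply/negPn/negP => /minm; lia.
have v l h z : l <= m -> views (f l) h z = cell z (pick3 (i - l) (j - l) l h).
  by move=> lm; rewrite views_place //; lia.
have f0 : place i j 0 = f 0 by rewrite /f !subn0.
rewrite /decides f0; apply: (@runs_seq _ _ _ true (f m)).
  apply: runs_while => [l lm|]; rewrite !v //=; try lia.
  split; first exact: prev.
  by rewrite moves_place /=; try lia; congr place; lia.
have -> : suffix (take j (W b)) (take i (W c)) = is_sep (views (f m) head_j b).
  rewrite v // is_sep_cell /= subn_eq0 suffixE !size_takel ?sizeW //.
  apply/eqP/idP => [E|jm].
    have szE := congr1 size E; rewrite size_drop !size_takel ?sizeW // in szE.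
    rewrite leqNgt; apply/negP => m_j; move: nm; rewrite matchE m_j /=.
    have := congr1 (fun u => nth false u (j - m.+1)) E.
    rewrite nth_drop !nth_take; try lia.
    have -> : i - j + (j - m.+1) = i - m.+1 by lia.
    by move=> ->; rewrite eqxx; lia.
  have sz : size (drop (i - j) (take i (W c))) = j.
    by rewrite size_drop size_takel ?sizeW //; lia.
  apply: (@eq_from_nth _ false); rewrite sz ?size_takel ?sizeW // => l lj.
  rewrite nth_drop !nth_take; try lia.
  have /prev : j - l.+1 < m by lia.
  rewrite matchE => /and3P[_ _ /eqP].
  have -> : i - (j - l.+1).+1 = i - j + l by lia.
  by have -> : j - (j - l.+1).+1 = l by lia.
apply: (runs_finish (fun u => is_sep (u head_j b))).
  move=> l lm; rewrite v //= is_sep_cell; split=> //.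
  by rewrite moves_place /=; try lia; congr place; lia.
by rewrite v //= is_sep_cell.
Qed.

Definition coversb (s c : bool) : bool :=
  ~~ has (fun i => overlap (W s) (W c) i && ~~ has (fun j =>
        overlap (W (~~ s)) (W true) j && suffix (take j (W true)) (take i (W c))
     || overlap (W (~~ s)) (W false) j && suffix (take j (W false)) (take i (W c)))
     (iota 1 n)) (iota 1 n).

Lemma decides_covers s c : decides (coversg s c) (place 0 0 0) (coversb s c).
Proof.
apply: decides_not.
apply: (@decides_exists head_i _ (fun i => place i 0 0)) => [t tn|t tn|t tn|i i_n].
- by rewrite views_place.
- by rewrite moves_place //=; [congr place; lia|lia].
- by rewrite moves_place //=; congr place; lia.
apply: decides_and.
  have := @decides_overlap head_i s c i 0; rewrite /along /= addn0; apply=> //; lia.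
apply: decides_not.
apply: (@decides_exists head_j _ (fun j => place i j 0)) => [t tn|t tn|t tn|j j_n].
- by rewrite views_place //; lia.
- by rewrite moves_place //=; try lia; congr place; lia.
- by rewrite moves_place //=; try lia; congr place; lia.
apply: decides_or; apply: decides_and.
- have := @decides_overlap head_j (~~ s) true j i; rewrite /along /= addn0; apply=> //; lia.
- by apply: decides_suffix; lia.
- have := @decides_overlap head_j (~~ s) false j i; rewrite /along /= addn0; apply=> //; lia.
- by apply: decides_suffix; lia.
Qed.

Lemma runs_calR : runs calRg (place n.+1 n.+1 n.+1)
  [&& W false != W true, coversb true true && coversb true false
    & coversb false true && coversb false false] (place 0 0 0).
Proof.
apply: (@runs_seq _ _ _ true (place 0 0 0)).
  have := @runs_while (fun u => ~~ is_sep (u head_i true)) (fun=> MoveL)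
    (fun l => place (n.+1 - l) (n.+1 - l) (n.+1 - l)) n.+1.
  rewrite subn0 subnn; apply; last by rewrite views_place // is_sep_cell.
  move=> l ln; rewrite views_place ?is_sep_cell /=; try lia.
  split; first by lia.
  by rewrite moves_place /=; try lia; congr place; lia.
apply: decides_and; last by do 2?apply: decides_and; exact: decides_covers.
have -> : (W false != W true) = ~~ overlap (W false) (W true) 0.
  by rewrite /overlap drop0 subn0 take_size eq_sym.
by apply: decides_not; have := @decides_overlap head_i false true 0 0; apply.
Qed.

End Runs.
End Gadgets.

(** * Simulation by Turing machines *)

Section Embedding.
Local Open Scope nat_scope.

Lemma either_word (W : bool -> word) s (c : word) :
  (c = W s \/ c = W (~~ s)) <-> exists b, c = W b.
Proof.
split=> [[] ->|[b ->]]; [by exists s|by exists (~~ s)|].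
by case: b; case: s; auto.
Qed.

Lemma coversb_covers n (W : bool -> word) s : (forall c, size (W c) = n) ->
  coversb n W s true && coversb n W s false <-> covers (W s) (W (~~ s)).
Proof.
move=> sz.
have one c : coversb n W s c <-> forall i, 0 < i <= n -> overlap (W s) (W c) i ->
    exists b j, [/\ 0 < j <= n, overlap (W (~~ s)) (W b) j
                  & suffix (take j (W b)) (take i (W c))].
  split=> [/hasPn H i i_n ov|H].
    have /H : i \in iota 1 n by rewrite mem_iota; lia.
    rewrite ov /= negbK => /hasP[j]; rewrite mem_iota => jn.
    by case/orP => /andP[ovj sj]; [exists true, j|exists false, j]; split=> //; lia.
  apply/hasPn => i; rewrite mem_iota => i_n; rewrite negb_and negbK.
  have [ov|//] := boolP (overlap _ _ _).
  have [||b [j [jn ovj sj]]] := H i; [lia|exact: ov|].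
  apply/hasP; exists j; first by rewrite mem_iota; lia.
  by case: b ovj sj => -> ->; rewrite ?orbT.
split=> [/andP[/one H1 /one H2] c i /either_word[b ->]|H].
  rewrite !sz => i_n ov.
  have [b' [j [? ? ?]]] : exists b' j, [/\ 0 < j <= n, overlap (W (~~ s)) (W b') j
                  & suffix (take j (W b')) (take i (W b))].
    by case: b ov; [exact: H1|exact: H2].
  by exists (W b'), j; split=> //; apply/either_word; exists b'.
have H' c : coversb n W s c.
  apply/one => i i_n ov.
  have cW : W c = W s \/ W c = W (~~ s) by apply/either_word; exists c.
  have i_n' : 0 < i <= size (W s) by rewrite sz.
  have [b [j [/either_word[b' ->] jn ovj sj]]] := H _ _ cW i_n' ov.
  by exists b', j; rewrite -(sz (~~ s)).
by rewrite !H'.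
Qed.

Definition head_cell := (head_name * bool)%type.

(** Tape [ord0] is the input; each of the six pairs of a head and a word has a work tape of its
    own. *)
Definition tape_of (t : head_cell) : 'I_#|{: head_cell}|.+1 :=
  lift ord0 (enum_rank t).

Definition on_tapes (A : Type) (a0 : A) (a : head_cell -> A)
    (i : 'I_#|{: head_cell}|.+1) : A :=
  if unlift ord0 i is Some j then a (enum_val j) else a0.

Lemma on_tapes_tape_of (A : Type) (a0 : A) a t :
  on_tapes a0 a (tape_of t) = a t.
Proof. by rewrite /on_tapes /tape_of liftK enum_rankK. Qed.

Lemma on_tapes0 (A : Type) (a0 : A) a : on_tapes a0 a ord0 = a0.
Proof. by rewrite /on_tapes unlift_none. Qed.

Lemma tapesP (P : 'I_#|{: head_cell}|.+1 -> Prop) :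
  P ord0 -> (forall t, P (tape_of t)) -> forall i, P i.
Proof.
move=> P0 Pt i; case: (unliftP ord0 i) => [j ->|->] //.
by rewrite -(enum_valK j); exact: Pt.
Qed.

(* The heads of a gadget never leave the cells between the marker [Sep] and
   the first blank. *)
Definition clamp (a : symbol) (m : move) : move :=
  match a, m with Sep, MoveL => Stay | Blank, MoveR => Stay | _, _ => m end.

(* The control states are: [inl None], the initial one, in which the markers
   are written; [inl (Some s)], copying the first ([s = true]) or the second
   input word to the tapes [(_, s)]; [inr q], running the gadget. *)
Definition tm_state (g : gadget) : finType := (option bool + (gstate g + bool))%type.

Definition tm_delta (g : gadget) (q : tm_state g)
    (u : 'I_#|{: head_cell}|.+1 -> symbol) :
    tm_state g * ('I_#|{: head_cell}|.+1 -> symbol * move) :=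
  let idle t := (u (tape_of t), Stay) in
  match q with
  | inl None => (inl (Some true),
      on_tapes (u ord0, Stay) (fun=> (Sep, MoveR)))
  | inl (Some s) =>
      match u ord0 with
      | Bit b => (inl (Some s), on_tapes (Bit b, MoveR)
          (fun t => if t.2 == s then (Bit b, MoveR) else idle t))
      | Sep => (inl (Some false), on_tapes (Sep, MoveR) idle)
      | Blank => (inr (inl (gstart g)), on_tapes (Blank, Stay) idle)
      end
  | inr (inl s) =>
      let: (q', mv) := gtrans s (fun h c => u (tape_of (h, c))) in
      (inr q', on_tapes (u ord0, Stay)
         (fun t => (u (tape_of t), clamp (u (tape_of t)) (mv t.1))))
  | inr (inr b) => (q, on_tapes (u ord0, Stay) idle)
  end.

Definition tm_of (g : gadget) : TM :=
  @MkTM (tm_state g) #|{: head_cell}| (inl None)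
    (fun q => if q is inr (inr b) then Some b else None) (@tm_delta g).

Definition setup_config (g : gadget) (s : bool) (l z : seq symbol)
    (T : bool -> seq symbol) : config (tm_of g) :=
  @Config (tm_of g) (inl (Some s))
    (on_tapes (Tape l (head Blank z) (behead z)) (fun t => Tape (T t.2) Blank [::])).

Lemma config_eq (M : TM) (q q' : state M) (T T' : 'I_(tapes M).+1 -> tape) :
  q = q' -> (forall i, T i = T' i) -> Config q T = Config q' T'.
Proof. by move=> -> /funext ->. Qed.

Lemma iter_copy g s l (u : word) z T : exists l',
  iter (size u) (@step (tm_of g)) (setup_config g s l (map Bit u ++ z) T)
  = setup_config g s l' z (fun c => if c == s then rev (map Bit u) ++ T c else T c).
Proof.
elim: u l T => [|b u IH] l T.
  exists l; rewrite /=; congr setup_config; apply/funext => c; by case: ifP.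
have [l' E] := IH (Bit b :: l) (fun c => if c == s then Bit b :: T c else T c).
exists l'; rewrite iterSr.
transitivity (setup_config g s l' z
  (fun c => if c == s then rev (map Bit u) ++ (if c == s then Bit b :: T c else T c)
            else (if c == s then Bit b :: T c else T c))); last first.
  congr setup_config; apply/funext => c; case: (c == s) => //=.
  by rewrite rev_cons cat_rcons.
rewrite -E; congr (iter _ _ _); rewrite /step /= on_tapes0 /=.
apply: config_eq => //; apply: tapesP => [|t]; first by rewrite !on_tapes0.
by rewrite !on_tapes_tape_of /=; case: ifP.
Qed.

Lemma shift_le n m x : x <= n.+1 -> shift n m x <= n.+1.
Proof. by case: m => //= xn; lia. Qed.

Definition tape_at (l : seq symbol) (x : nat) : tape :=
  Tape (rev (take x l)) (nth Blank l x) (drop x.+1 l).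

(** Clamping on the marker and on the blank matches the saturation in [shift]. Writing the final
    blank explicitly in [l] keeps the head inside this list, so the represented tapes are equal as
    records, without padding. *)
Lemma write_move_at (n : nat) (u : word) (x : nat) (m : move) :
  size u = n -> x <= n.+1 ->
  let l := Sep :: map Bit u ++ [:: Blank] in
  write_move (tape_at l x) (nth Blank l x, clamp (nth Blank l x) m)
  = tape_at l (shift n m x).
Proof.
move=> szu xn l.
have szl : size l = n.+2 by rewrite /= size_cat size_map /= szu addn1.
have lE y : 0 < y <= n -> exists b, nth Blank l y = Bit b.
  case: y => // y yn; exists (nth false u y).
  by rewrite /= nth_cat size_map szu ifT ?(nth_map false) ?szu.
have l_end : nth Blank l n.+1 = Blank.
  by rewrite /= nth_cat size_map szu ltnn subnn.
have l0 : nth Blank l 0 = Sep by [].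
clearbody l.
have right_at y : y <= n ->
    write_move (tape_at l y) (nth Blank l y, MoveR) = tape_at l y.+1.
  move=> yn; have yl : y < size l by rewrite szl; lia.
  rewrite /tape_at /=; congr Tape.
  - by rewrite (take_nth Blank yl) rev_rcons.
  - by rewrite -nth0 nth_drop addn0.
  - by rewrite -drop1 drop_drop add1n.
have left_at y : y <= n ->
    write_move (tape_at l y.+1) (nth Blank l y.+1, MoveL) = tape_at l y.
  move=> yn; have yl : y < size l by rewrite szl; lia.
  rewrite /tape_at /= (take_nth Blank yl) rev_rcons; congr Tape => /=.
  by rewrite -drop_nth // szl; lia.
case: m; rewrite [shift _ _ _]/=.
- case: x xn => [|x] xn; first by rewrite l0 /tape_at /= l0.
  have -> : clamp (nth Blank l x.+1) MoveL = MoveL.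
    have [xn'|nx] := ltnP x n; first by have [|b ->] := lE x.+1.
    by have -> : x = n by [lia]; rewrite l_end.
  exact: left_at.
- have [xn'|nx] := leqP x n; last first.
    have -> : x = n.+1 by lia.
    by rewrite {2}l_end (minn_idPr _) //.
  have -> : clamp (nth Blank l x) MoveR = MoveR.
    by case: x xn xn' => [|x] xn xn'; rewrite ?l0 //; have [//|b ->] := lE x.+1.
  by rewrite right_at //; congr tape_at; lia.
- by have -> : clamp (nth Blank l x) Stay = Stay by case: (nth _ _ _).
Qed.

Section Simulation.
Variables (g : gadget) (n : nat) (W : bool -> word) (T0 : tape).
Hypothesis sizeW : forall s, size (W s) = n.

Definition content (s : bool) : seq symbol := Sep :: map Bit (W s) ++ [:: Blank].

Lemma nth_content s x : nth Blank (content s) x = cell W s x.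
Proof.
rewrite /content /cell -cat_cons nth_cat; case: ltnP => // H.
rewrite [RHS]nth_default //; case: (_ - _) => [|k] //=; exact: nth_nil.
Qed.

Definition embed (c : gconfig n g) : config (tm_of g) :=
  @Config (tm_of g) (inr c.1)
    (on_tapes T0 (fun t => tape_at (content t.2) (c.2 t.1))).

(** One machine step simulates one gadget step exactly; halted configurations are fixed on both
    sides. *)
Lemma step_embed c : step (embed c) = embed (gstep W c).
Proof.
case: c => -[s|b] p //; rewrite /step /gstep /=.
have -> : (fun h c => cur (on_tapes T0 (fun t => tape_at (content t.2) (p t.1))
    (tape_of (h, c)))) = views W p.
  by apply/funext => h; apply/funext => c; rewrite on_tapes_tape_of /= nth_content.
case: (gtrans s _) => q mv; apply: config_eq => //.
apply: tapesP => [|t]; first by rewrite !on_tapes0; case: (T0).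
have pn : p t.1 <= n.+1 by rewrite -ltnS.
rewrite !on_tapes_tape_of; apply: etrans (write_move_at (mv t.1) (sizeW t.2) pn) _.
by rewrite ffunE inordK // ltnS shift_le.
Qed.

Lemma iter_embed m c : iter m (@step (tm_of g)) (embed c) = embed (iter m (gstep W (g:=g)) c).
Proof. by elim: m => //= m ->; rewrite step_embed. Qed.

End Simulation.

Lemma setup g n (W : bool -> word) : (forall s, size (W s) = n) -> exists T0,
  iter (2 * n + 3) (@step (tm_of g)) (init (tm_of g) (encode_pair (W true) (W false)))
  = embed W T0 (inl (gstart g), place n n.+1 n.+1 n.+1).
Proof.
move=> sz.
set S := @step (tm_of g); set c0 := init _ _.
have E1 : S c0 = setup_config g true [::] (map Bit (W true) ++ Sep :: map Bit (W false))
    (fun=> [:: Sep]).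
  rewrite /S /step /=; apply: config_eq => //; apply: tapesP => [|t].
    rewrite !on_tapes0 eqxx /encode_pair /input_tape.
    by case: (map Bit (W true)).
  by rewrite !on_tapes_tape_of.
have [l1 E2] := iter_copy g true [::] (W true) (Sep :: map Bit (W false)) (fun=> [:: Sep]).
rewrite -E1 sz in E2.
set T1 := (fun c : bool => _) in E2.
have E3 : S (setup_config g true l1 (Sep :: map Bit (W false)) T1) =
    setup_config g false (Sep :: l1) (map Bit (W false) ++ [::]) T1.
  rewrite /S /step /= on_tapes0 /=; apply: config_eq => //.
  by rewrite cats0; apply: tapesP => [|t]; rewrite ?on_tapes0 // !on_tapes_tape_of.
have [l2 E4] := iter_copy g false (Sep :: l1) (W false) [::] T1.
rewrite sz -E3 -E2 in E4.
exists (Tape l2 Blank [::]).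
(* Read from right to left, which is the order of execution: write the markers, copy the first word,
   cross the separator, copy the second word, detect the blank. *)
have -> : 2 * n + 3 = 1 + (n + (1 + (n + 1))) by lia.
rewrite !iterD [iter 1 S c0]/= -/S.
rewrite !(iterD, iterS) /= in E4 *.
rewrite E4 {1}/S /step /= on_tapes0 /=; apply: config_eq => //.
apply: tapesP => [|t]; rewrite ?on_tapes0 // !on_tapes_tape_of /=.
rewrite ffunE inordK; last by case: t => -[[]|].
have -> : pick3 n.+1 n.+1 n.+1 t.1 = n.+1 by case: t => -[[]|].
rewrite /tape_at.
rewrite /content -cat_cons take_cat drop_cat nth_cat /= size_map sz !ltnn subnn.
rewrite ltnNge leqnSn /= cats0 subSnn /=.
by congr Tape; rewrite /T1 rev_cons -cats1; case: t.2 => /=; rewrite ?rev_cons -?cats1.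
Qed.

Lemma step_halted (M : TM) (c : config M) b m :
  answer (cstate c) = Some b -> iter m (@step M) c = c.
Proof. by move=> cb; elim: m => //= m ->; rewrite /step cb. Qed.

Lemma card_gconfig n g : #|{: gconfig n g}| = (#|gstate g| + 2) * n.+2 ^ 3.
Proof.
by rewrite card_prod card_sum card_bool card_ffun card_ord card_option card_bool.
Qed.

(* A halting run does not repeat a configuration, so their number bounds its
   length. *)
Lemma tm_of_halts g n (W : bool -> word) b p m :
  (forall s, size (W s) = n) ->
  runs W g (place n n.+1 n.+1 n.+1) b p ->
  2 * n + 3 + (#|gstate g| + 2) * n.+2 ^ 3 <= m ->
  halts_within (tm_of g) (encode_pair (W true) (W false)) m b.
Proof.
move=> sz gb nm; have [T0 E0] := setup g sz.
have gb' := iter_findex gb; have := findex_max gb; set k := findex _ _ _ in gb' *.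
move=> /leq_trans/(_ (max_card _)); rewrite card_gconfig => kc.
have E : iter (k + (2 * n + 3)) (@step (tm_of g)) (init (tm_of g) (encode_pair (W true) (W false)))
    = embed W T0 (inr b, p) by rewrite iterD E0 iter_embed // gb'.
have -> : m = m - (k + (2 * n + 3)) + (k + (2 * n + 3)) by lia.
by rewrite /halts_within iterD E (@step_halted _ _ b).
Qed.

Lemma horner_time (a b c d x : nat) :
  (a%:P * 'X + b%:P + c%:P * ('X + d%:P) ^+ 3).[x]%R = a * x + b + c * (x + d) ^ 3.
Proof. by rewrite !(hornerD, hornerM, hornerC, hornerX, horner_exp). Qed.

Lemma calR_polytime : polytime_decidable calR.
Proof.
(* The linear part is the setup time; the cubic part counts the gadget configurations: the states
   and the two exits, times the positions of three heads on [n.+2] cells. *)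
exists (tm_of calRg), (2%N%:P * 'X + 3%N%:P + (#|gstate calRg| + 2)%N%:P * ('X + 2%N%:P) ^+ 3)%R.
move=> v w sz; pose W s := if s then v else w.
have sW s : size (W s) = size v by case: s.
have run := runs_calR sW; set b := [&& _, _ & _] in run.
exists b.
  apply: (tm_of_halts sW run).
  by rewrite horner_time (addn2 (size v)).
rewrite /b; apply: (iff_trans _ (iff_sym (calR_covers sz))).
have cv := coversb_covers true sW; have cw := coversb_covers false sW.
split=> [/and3P[/eqP vw /cv v_w /cw w_v]|[vw v_w w_v]].
  by split; [move/esym|exact: v_w|exact: w_v].
by apply/and3P; split; [apply/eqP => /esym|apply/cv|apply/cw].
Qed.

End Embedding.

(** * Winning probabilities *)

Section Race.
Local Open Scope nat_scope.

Lemma take_mkseq (A : Type) (f : nat -> A) m n :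
  m <= n -> take m (mkseq f n) = mkseq f m.
Proof. by move=> mn; rewrite /mkseq -map_take take_iota (minn_idPl mn). Qed.

Lemma occurs_at_suffix (x : nat -> bool) (u : word) t :
  occurs_at x u t <-> suffix u (mkseq x t).
Proof.
rewrite suffixE size_mkseq /mkseq -map_drop drop_iota add0n.
split=> [[ut <-]|/eqP E].
  by rewrite size_map size_iota subKn.
have szE := congr1 size E; rewrite size_map size_iota in szE.
have ut : size u <= t by rewrite -szE leq_subr.
by split=> //; rewrite -[X in iota _ X](_ : t - (t - size u) = _) // subKn.
Qed.

Lemma occurs_in_prefix (x : nat -> bool) (u a b : word) t :
  mkseq x t = a ++ u ++ b ->
  occurs_at x u (size a + size u) /\ size a + size u + size b = t.
Proof.
move=> E; have tE : size a + size u + size b = t.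
  by rewrite -(size_mkseq x t) E !size_cat addnA.
split=> //; have st : size a + size u <= t by lia.
apply/occurs_at_suffix; rewrite -(take_mkseq _ st) E catA.
by rewrite take_size_cat ?size_cat //; exact: suffix_suffix.
Qed.

Lemma infix_prefix_occurs (x : nat -> bool) (u : word) s t :
  s <= t -> occurs_at x u s -> infix u (mkseq x t).
Proof.
move=> st /occurs_at_suffix su; rewrite -(cat_take_drop s (mkseq x t)).
by rewrite take_mkseq //; apply: infix_catr; exact: suffixW su.
Qed.

Lemma first_occurrence_OmegaStar (x : nat -> bool) (v w : word) :
  (exists2 t, occurs_at x v t & forall s, s <= t -> ~ occurs_at x w s) <->
  exists2 y, OmegaStar v w y & mkseq x (size (y ++ v)) = y ++ v.
Proof.
split=> [[t0 ov0 nw0]|[y [_ occ nw] E]]; last first.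
  exists (size (y ++ v)).
    by apply/occurs_at_suffix; rewrite E; exact: suffix_suffix.
  move=> s st ow; case/negP: nw; rewrite -E; exact: infix_prefix_occurs ow.
have ex : exists t, `[< occurs_at x v t >] by exists t0; apply/asboolP.
(* Cutting at the first occurrence of [v] makes [v] occur only as a suffix; as [t <= t0], the word
   [w] is still absent. *)
case: (ex_minnP ex) => t /asboolP ov tmin.
have tt0 : t <= t0 by apply: tmin; apply/asboolP.
have /suffixP[y E] : suffix v (mkseq x t) by apply/occurs_at_suffix.
have szE : size (y ++ v) = t by rewrite -E size_mkseq.
exists y; last by rewrite szE.
split; first exact: suffix_suffix.
  move=> a b; rewrite -E => E'; have [ov' tE] := occurs_in_prefix E'.
  have /tmin : `[< occurs_at x v (size a + size v) >] by apply/asboolP.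
  by move=> ?; apply: size0nil; lia.
rewrite -E; apply/negP => /infixP[a [b E']].
have [ow tE] := occurs_in_prefix E'; apply: nw0 ow; lia.
Qed.

(** Of two prefixes of the same sequence, the shorter one begins the longer one; since [v] occurs in
    the longer one only as a suffix, they coincide. This gives the disjointness of the cylinders. *)
Lemma OmegaStar_prefix_inj (v w y y' : word) (x : nat -> bool) :
  OmegaStar v w y -> OmegaStar v w y' ->
  mkseq x (size (y ++ v)) = y ++ v -> mkseq x (size (y' ++ v)) = y' ++ v ->
  y = y'.
Proof.
wlog le : y y' / size (y ++ v) <= size (y' ++ v).
  move=> H Oy Oy' E E'; case: (leqP (size (y ++ v)) (size (y' ++ v))) => [le|/ltnW le].
    exact: H.
  by apply/esym; exact: H.
move=> _ [_ occ _] E E'.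
have E2 : y' ++ v = y ++ v ++ drop (size (y ++ v)) (y' ++ v).
  have tk : take (size (y ++ v)) (y' ++ v) = y ++ v.
    by rewrite -{1}E' take_mkseq.
  by rewrite catA -[X in _ = X ++ _]tk cat_take_drop.
move: (occ _ _ E2) => d0; rewrite d0 cats0 in E2.
have szE : size y' = size y by have := congr1 size E2; rewrite !size_cat; lia.
by move/eqP: E2; rewrite eqseq_cat // => /andP[/eqP ->].
Qed.

Lemma hitting_time_lt (R : realType) (x : nat -> bool) (v w : word) :
  (hitting_time R x v < hitting_time R x w)%E <->
  exists2 t, occurs_at x v t & forall s, s <= t -> ~ occurs_at x w s.
Proof.
split.
  case/ereal_inf_lt => _ [t ov <-] tw; exists t => // s st ow.
  have : (hitting_time R x w <= s%:R%:E)%E.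
    by apply: ereal_inf_lbound; exists s.
  move=> /(lt_le_trans tw); rewrite lte_fin ltr_nat; lia.
case=> t ov nw; apply: (@le_lt_trans _ _ (t%:R%:E)).
  by apply: ereal_inf_lbound; exists t.
(* The value [t.+1] bounds all occurrence times of [w] from below, so the inequality stays strict
   after taking the infimum, even if [w] never occurs. *)
apply: (@lt_le_trans _ _ (t.+1%:R%:E)); first by rewrite lte_fin ltr_nat.
apply: le_ereal_inf_tmp => _ [s ow <-]; rewrite lee_fin ler_nat ltnNge.
by apply/negP => st; exact: nw st ow.
Qed.

End Race.

(** * Algebra of word probabilities *)

Section WordProbability.
Variables (R : realType) (p : R).

Lemma word_prob_cat u v :
  word_prob p (u ++ v) = word_prob p u * word_prob p v.
Proof.
rewrite /word_prob /norm1 /norm0 !count_cat !exprD; ring.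
Qed.

Lemma word_prob_prod u :
  word_prob p u = \prod_(b <- u) (if b then p else 1 - p).
Proof.
elim: u => [|b u IH]; first by rewrite big_nil /word_prob /= mulr1.
rewrite big_cons -IH -cat1s word_prob_cat; congr *%R.
by case: b; rewrite /word_prob /norm1 /norm0 /= ?expr1 ?expr0 ?mulr1 ?mul1r.
Qed.

Hypothesis p01 : 0 < p < 1.

Lemma word_prob_gt0 u : 0 < word_prob p u.
Proof. by case/andP: p01 => p0 p1; rewrite mulr_gt0 ?exprn_gt0 ?subr_gt0. Qed.

(** By equality of lengths, [w] has [s] more zeros than [v], so that P(v) = P(w) r with
    [r = p ^ s / (1 - p) ^ s]. *)
Lemma word_prob_odds v w : size v = size w ->
  let s : int := (norm1 v)%:Z - (norm1 w)%:Z in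
  word_prob p v / (word_prob p v + word_prob p w) = p ^ s / (p ^ s + (1 - p) ^ s).
Proof.
move=> sz s; case/andP: p01 => p0 p1; have q0 : 0 < 1 - p by rewrite subr_gt0.
have szE (u : word) : size u = (norm1 u + norm0 u)%N.
  rewrite /norm1 /norm0 -(count_predC (pred1 true) u); congr addn.
  by apply: eq_count => -[].
have s1 : (norm1 v)%:Z = (norm1 w)%:Z + s by rewrite /s; lia.
have s0 : (norm0 v)%:Z = (norm0 w)%:Z - s by move: sz; rewrite !szE /s; lia.
clearbody s.
pose r := p ^ s / (1 - p) ^ s.
have vE : word_prob p v = word_prob p w * r.
  rewrite /word_prob !exprnP s1 s0 !expfzDr ?gt_eqF // -invr_expz.
  by rewrite mulrACA.
have rE : (1 - p) ^ s * r = p ^ s.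
  by rewrite /r mulrCA divff ?mulr1 // expfz_neq0 // gt_eqF.
have w0 := word_prob_gt0 w.
have ps : 0 < p ^ s by rewrite exprz_gt0.
have qs : 0 < (1 - p) ^ s by rewrite exprz_gt0.
have r0 : 0 < r by rewrite divr_gt0.
rewrite vE -rE; field.
by rewrite !gt_eqF // addr_gt0 // mulr_gt0.
Qed.

End WordProbability.

(** * Cylinders, almost sure occurrence and the winning probability *)

Section Bits.
Variables (R : realType) (d : measure_display) (T : measurableType d).
Variables (P : probability T R) (X : nat -> {RV P >-> bool}) (p : R).
Hypothesis iidX : iid_bits P X p.

Let bits (o : T) : nat -> bool := fun i => X i o.

Definition cylinder (u : word) : set T := [set o | mkseq (bits o) (size u) = u].

Lemma measurable_bit i (B : set bool) : measurable (X i @^-1` B).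
Proof. exact: measurable_funPTI. Qed.

Lemma prob_bit i b : P (X i @^-1` [set b]) = (if b then p else 1 - p)%:E.
Proof.
case: b; first exact: iidX.1.
have -> : X i @^-1` [set false] = ~` (X i @^-1` [set true]).
  by apply/seteqP; split=> o /=; case: (X i o).
by rewrite probability_setC; [rewrite iidX.1|exact: measurable_bit].
Qed.

Lemma cylinder_bigcap u : cylinder u =
  \bigcap_(j in [set` seq_fset imfset_key (iota 0 (size u))])
    X j @^-1` [set nth false u j].
Proof.
apply/seteqP; split=> o /=.
  move=> ou j /=; rewrite seq_fsetE mem_iota => /andP[_ ju].
  by rewrite -ou nth_mkseq.
move=> H; apply: (@eq_from_nth _ false); rewrite size_mkseq // => j ju.
by rewrite nth_mkseq //; apply: H; rewrite /= seq_fsetE mem_iota.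
Qed.

Lemma measurable_cylinder u : measurable (cylinder u).
Proof.
rewrite cylinder_bigcap; apply: fin_bigcap_measurable.
  exact: finite_fset.
by move=> j _; exact: measurable_bit.
Qed.

Lemma prob_cylinder u : P (cylinder u) = (word_prob p u)%:E.
Proof.
rewrite cylinder_bigcap (iidX.2 _ (fun j => [set nth false u j])).
have /(perm_big _) -> := seq_fset_perm imfset_key (iota 0 (size u)).
rewrite undup_id ?iota_uniq // word_prob_prod.
under eq_bigr do rewrite prob_bit.
by rewrite prodEFin -[in RHS](mkseq_nth false u) /mkseq big_map.
Qed.

Lemma prob_cylinder_cat u v :
  P (cylinder (u ++ v)) = (P (cylinder u) * P (cylinder v))%E.
Proof. by rewrite !prob_cylinder word_prob_cat EFinM. Qed.

(** An event on the first [N] bits is a finite disjoint union of cylinders, and appending [v]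
    multiplies the probability of each by that of [v]. *)
Lemma bits_indep N (Q : word -> Prop) (v : word) :
  let A := [set o | Q (mkseq (bits o) N)] in
  let B := [set o | map (bits o) (iota N (size v)) = v] in
  [/\ measurable A, measurable (A `&` B) &
      P (A `&` B) = (P A * P (cylinder v))%E].
Proof.
move=> A B; pose I := [set u : N.-tuple bool | Q u].
have finI : finite_set I by exact: finite_finset.
have AE : A = \bigcup_(u in I) cylinder u.
  apply/seteqP; split=> o /=.
    move=> Qo; have sN : size (mkseq (bits o) N) == N by rewrite size_mkseq.
    by exists (Tuple sN) => //=; rewrite /cylinder /= size_mkseq.
  by case=> u Iu; rewrite /cylinder /A /= size_tuple => ->.
have mE : A `&` B = \bigcup_(u in I) cylinder (u ++ v).
  have catE o : mkseq (bits o) (N + size v) =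
      mkseq (bits o) N ++ map (bits o) (iota N (size v)).
    by rewrite /mkseq iotaD map_cat.
  rewrite AE; apply/seteqP; split=> o /=.
    case=> -[u Iu ou] ov; exists u => //; rewrite /cylinder /= size_cat size_tuple catE.
    rewrite [map _ _]ov.
    by move: ou; rewrite /cylinder /= size_tuple => ->.
  case=> u Iu; rewrite /cylinder /= size_cat size_tuple catE => /eqP.
  rewrite eqseq_cat ?size_mkseq ?size_tuple // => /andP[/eqP ou /eqP ov].
  by split=> //; exists u => //; rewrite /cylinder /= size_tuple.
have triv : trivIset I (fun u => cylinder (u ++ v)).
  move=> u u' _ _ [z []]; rewrite /cylinder /= !size_cat !size_tuple => ->.
  by move/eqP; rewrite eqseq_cat ?size_tuple // => /andP[/eqP/val_inj].
have triv0 : trivIset I (fun u => cylinder u).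
  by move=> u u' _ _ [z []]; rewrite /cylinder /= !size_tuple => -> /val_inj.
split.
- by rewrite AE; apply: fin_bigcup_measurable => // *; exact: measurable_cylinder.
- by rewrite mE; apply: fin_bigcup_measurable => // *; exact: measurable_cylinder.
rewrite mE AE !measure_fin_bigcup // => [| * | *]; try exact: measurable_cylinder.
rewrite ge0_mule_fsuml //; apply: eq_fsbigr => u _; exact: prob_cylinder_cat.
Qed.

Hypothesis p01 : 0 < p < 1.

(** Only disjoint blocks of length [size v] are inspected; their independence makes the probability
    decay geometrically in [m]. *)
Definition block_free (v : word) (m : nat) : set T :=
  [set o | forall j, (j < m)%N -> map (bits o) (iota (j * size v) (size v)) <> v].

Lemma prob_block_free v m :
  measurable (block_free v m) /\ P (block_free v m) = ((1 - word_prob p v) ^+ m)%:E.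
Proof.
have qE i N (x : nat -> bool) : (i + size v <= N)%N ->
    map x (iota i (size v)) = take (size v) (drop i (mkseq x N)).
  move=> iN; rewrite /mkseq -map_drop -map_take drop_iota take_iota add0n.
  by congr (map _ (iota _ _)); lia.
pose Q m u := forall j, (j < m)%N -> take (size v) (drop (j * size v) u) <> v.
have BE k : block_free v k = [set o | Q k (mkseq (bits o) (k * size v))].
  apply/seteqP; split=> o H j jk; have := H j jk;
    by rewrite /= (qE _ (k * size v)%N) // -mulSnr leq_mul2r jk orbT.
have mB k : measurable (block_free v k) by rewrite BE; case: (bits_indep (k * size v) (Q k) v).
split=> //; elim: m => [|m IH].
  rewrite expr0; have -> : block_free v 0 = setT by apply/seteqP; split.
  exact: probability_setT.
(* The removed event joins a condition on the first [m * size v] bits with a condition on the next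
   block, as [bits_indep] requires. *)
have SE : block_free v m.+1 = block_free v m `\` (block_free v m `&`
    [set o | map (bits o) (iota (m * size v) (size v)) = v]).
  apply/seteqP; split=> o /=.
    move=> H; split; first by move=> j jm; apply: H; rewrite ltnS ltnW.
    by case=> _; exact: H.
  case=> H1 H2 j; rewrite ltnS leq_eqVlt => /orP[/eqP ->|/H1//] E.
  by apply: H2; split.
have [_ mI E] := bits_indep (m * size v) (Q m) v; rewrite -BE in mI E.
have fB : (P (block_free v m) < +oo)%E by rewrite IH ltry.
have PD := measureD (mB m) mI fB; rewrite setIA setIid in PD.
rewrite SE; apply: etrans PD _.
by rewrite [X in (X - _)%E]IH [X in (_ - X)%E]E IH prob_cylinder -EFinM -EFinB exprSr mulrBr mulr1.
Qed.

Lemma disjoint_win v w :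
  [set o | (hitting_time R (bits o) v < hitting_time R (bits o) w)%E] `&`
  [set o | (hitting_time R (bits o) w < hitting_time R (bits o) v)%E] = set0.
Proof. by apply/seteqP; split=> o //= [/lt_trans H /H]; rewrite ltxx. Qed.

(** Words are numbered so that sums over [OmegaStar] become series over the naturals; these range
    over codes of words only, where the default value is not taken. *)
Let wordn (k : nat) : word := odflt [::] (choice.unpickle k).

(** The series depends on the pair only through [OmegaStar v w]; hence it is the same for both
    players when the pair belongs to [calR]. *)
Lemma win_series v w :
  let E := [set o | (hitting_time R (bits o) v < hitting_time R (bits o) w)%E] in
  measurable E /\
  Win P X v w = ((word_prob p v)%:E *
    \sum_(k <oo | k \in [set choice.pickle y | y in OmegaStar v w])
      (word_prob p (wordn k))%:E)%E.
Proof.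
set D := [set choice.pickle y | y in OmegaStar v w] => E.
have EE : E = \bigcup_(k in D) cylinder (wordn k ++ v).
  apply/seteqP; split=> o /=.
    move/hitting_time_lt/first_occurrence_OmegaStar => [y Oy yo].
    by exists (choice.pickle y); [exists y | rewrite /cylinder /wordn choice.pickleK].
  case=> _ [y Oy <-]; rewrite /cylinder /wordn choice.pickleK /= => yo.
  by apply/hitting_time_lt/first_occurrence_OmegaStar; exists y.
have mC k : D k -> measurable (cylinder (wordn k ++ v)).
  by move=> _; exact: measurable_cylinder.
split; first by rewrite EE; exact: bigcup_measurable.
rewrite /Win -/bits -/E EE measure_bigcup //; last first.
  move=> _ _ [y Oy <-] [y' Oy' <-] [z]; rewrite /cylinder /wordn !choice.pickleK /= => -[yz y'z].
  by congr choice.pickle; exact: (OmegaStar_prefix_inj Oy Oy' yz y'z).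
rewrite -nneseriesZl; last by move=> k _; rewrite lee_fin ltW ?word_prob_gt0.
apply: eq_eseriesr => k _.
apply: etrans (prob_cylinder_cat _ _) _; by rewrite !prob_cylinder muleC.
Qed.

Lemma win_total v w : v <> w -> size v = size w ->
  (Win P X v w + Win P X w v = 1)%E.
Proof.
move=> vw sz; have [mA _] := win_series v w; have [mB _] := win_series w v.
rewrite /Win -/bits; set A := [set o | _] in mA *; set B := [set o | _] in mB *.
have mAB : measurable (A `|` B) by exact: measurableU.
rewrite -measureU //; last exact: disjoint_win.
(* If some block equals [v], the earliest occurrence of either word decides the race: distinct words
   of equal length cannot end at the same time. *)
have sub m : ~` (A `|` B) `<=` block_free v m.
  move=> o nAB j jm E; apply: nAB.
  have ex : exists t, `[< occurs_at (bits o) v t \/ occurs_at (bits o) w t >].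
    exists (j * size v + size v)%N; apply/asboolP; left; split; first by lia.
    by rewrite addnK.
  case: (ex_minnP ex) => t /asboolP ovw tmin.
  have early u s : u = v \/ u = w -> occurs_at (bits o) u s -> (t <= s)%N.
    by move=> uvw us; apply: tmin; apply/asboolP; case: uvw us => ->; [left|right].
  have same : occurs_at (bits o) v t -> occurs_at (bits o) w t -> False.
    by case=> _ vt [_ wt]; apply: vw; rewrite -vt -wt sz.
  case: ovw => ot; [left|right]; apply/hitting_time_lt; exists t => // s st os.
    have := early w s (or_intror erefl) os => ts.
    have ste : s = t by lia.
    by rewrite ste in os; exact: same ot os.
  have := early v s (or_introl erefl) os => ts.
  have ste : s = t by lia.
  by rewrite ste in os; exact: same os ot.
have q0 := word_prob_gt0 p01 v.
have q1 : word_prob p v <= 1.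
  by rewrite -lee_fin -prob_cylinder; apply: probability_le1; exact: measurable_cylinder.
have le m : (P (~` (A `|` B)) <= ((1 - word_prob p v) ^+ m)%:E)%E.
  have [mF <-] := prob_block_free v m.
  by apply: le_measure; rewrite ?inE //; exact: measurableC.
have fin : P (~` (A `|` B)) \is a fin_num by exact: fin_num_measure (measurableC mAB).
have PC0 : P (~` (A `|` B)) = 0%E.
  apply/eqP; rewrite eq_le measure_ge0 andbT -(fineK fin) lee_fin.
  have cv : (fun m => (1 - word_prob p v) ^+ m) @ \oo --> (0 : R).
    by apply: cvg_expr; rewrite ger0_norm; lra.
  rewrite -(cvg_lim _ cv) //; apply: limr_ge; first by apply/cvg_ex; exists 0.
  by apply: nearW => m; rewrite -lee_fin fineK.
by have := probability_setC P (measurableC mAB); rewrite setCK PC0 sube0.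
Qed.

Lemma win_formula v w : calR v w ->
  Win P X v w = (word_prob p v / (word_prob p v + word_prob p w))%:E.
Proof.
case=> vw sz OE; have := win_total vw sz.
have [_ ->] := win_series v w; have [_ ->] := win_series w v; rewrite OE.
set C := (\sum_(_ <oo | _) _)%E.
have C0 : (0 <= C)%E.
  by apply: nneseries_ge0 => k _ _; rewrite lee_fin ltW ?word_prob_gt0.
have v0 := word_prob_gt0 p01 v; have w0 := word_prob_gt0 p01 w.
(* An infinite sum would make the total winning probability infinite instead of 1. *)
case: C C0 => [c||] // _; last by rewrite !gt0_muley ?lte_fin.
rewrite -!EFinM -EFinD => -[E]; congr EFin.
have vw0 : word_prob p v + word_prob p w != 0 by rewrite gt_eqF // addr_gt0.
by apply: (mulIf vw0); rewrite divfK // -mulrA [c * _]mulrC mulrDl E mulr1.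
Qed.

End Bits.

Theorem theorem3p6 (R : realType) :
  (forall v w : word, calR v w ->
   forall p : R, 0 < p < 1 ->
   forall (d : measure_display) (T : measurableType d) (P : probability T R)
     (X : nat -> {RV P >-> bool}), iid_bits P X p ->
   let s : int := (norm1 v)%:Z - (norm1 w)%:Z in
   Win P X v w = (word_prob p v / (word_prob p v + word_prob p w))%:E /\
   word_prob p v / (word_prob p v + word_prob p w)
     = p ^ s / (p ^ s + (1 - p) ^ s))
  /\
  (forall v w : word, calR v w ->
   (forall p : R, 0 < p < 1 ->
    forall (d : measure_display) (T : measurableType d) (P : probability T R)
      (X : nat -> {RV P >-> bool})
      (d' : measure_display) (T' : measurableType d') (P' : probability T' R)
      (X' : nat -> {RV P' >-> bool}),
    iid_bits P X p -> iid_bits P' X' (1 - p) ->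
    Win P' X' v w = (1 - Win P X v w)%E) /\
   (norm1 v = norm1 w ->
    forall p : R, 0 < p < 1 ->
    forall (d : measure_display) (T : measurableType d) (P : probability T R)
      (X : nat -> {RV P >-> bool}), iid_bits P X p ->
    Win P X v w = (2^-1)%:E))
  /\
  polytime_decidable calR.
Proof.
split; last split; last exact: calR_polytime.
  move=> v w vRw p p01 d T P X iidX s; split; first exact: win_formula.
  by case: vRw => _ sz _; exact: word_prob_odds.
move=> v w vRw; have sz : size v = size w by case: vRw.
split=> [p p01 d T P X d' T' P' X' iidX iidX'|nvw p p01 d T P X iidX].
  have q01 : 0 < 1 - p < 1 by lra.
  rewrite (win_formula iidX p01 vRw) (win_formula iidX' q01 vRw).
  (* Replacing [p] by [1 - p] exchanges the two powers in the formula. *)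
  have pE : 1 - (1 - p) = p by ring.
  rewrite !word_prob_odds // pE; set s := ((norm1 v)%:Z - _)%R.
  have [p0 p1] := andP p01.
  have ps : 0 < p ^ s by rewrite exprz_gt0.
  have qs : 0 < (1 - p) ^ s by rewrite exprz_gt0 // subr_gt0.
  rewrite -EFinB; congr EFin; field.
  by rewrite !gt_eqF // addr_gt0.
rewrite (win_formula iidX p01 vRw) word_prob_odds // nvw subrr !expr0z.
by rewrite div1r.
Qed.
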